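(* Let $n\ge1$ be an integer, and let $\mathfrak{e}_n$ be the (Fraïssé) category whose objects are the elementary $\mathrm{Cu}$-semigroups $E_{n^k}$ with $k\in\mathbb{N}$ and whose morphisms are all the order-embeddings $E_{n^k}\to E_{n^s}$ given by multiplication by a power of $n$. Then the Fraïssé limit $\mathcal{E}_n$ of $\mathfrak{e}_n$ is a simple, non-stably finite, not weakly purely infinite $\mathrm{Cu}$-semigroup whose order is total.
   Context: **$\mathrm{Cu}$-semigroups.** For $x,y$ in a partially ordered set, $x\ll y$ means: for every increasing sequence $(z_n)_n$ having a supremum with $y\le\sup_n z_n$, there is $n$ with $x\le z_n$. A $\mathrm{Cu}$-semigroup is a positively ordered (commutative) monoid $S$ such that (O1) every increasing sequence has a supremum; (O2) every element is the supremum of a $\ll$-increasing sequence; (O3) $x'\ll x$ and $y'\ll y$ imply $x'+y'\ll x+y$; (O4) $\sup_n(x_n+y_n)=\sup_n x_n+\sup_n y_n$ for increasing sequences. A $\mathrm{Cu}$-morphism is a monoid morphism preserving the order, the relation $\ll$, and suprema of increasing sequences. $\mathrm{Cu}$ denotes the resulting category; it has inductive limits. An order-embedding between $\mathrm{Cu}$-semigroups always means a $\mathrm{Cu}$-morphism $\alpha$ such that $\alpha(x)\le\alpha(y)$ implies $x\le y$. $S$ is countably-based if there is a countable subset $B\subseteq S$ such that every element of $S$ is the supremum of a $\ll$-increasing sequence in $B$. **The semigroups $E_m$.** For $m\ge1$, $E_m=\{0,1,\ldots,m,\infty\}$ with its natural total order and with addition as in $\mathbb{N}$, except that $x+y=\infty$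 whenever the sum exceeds $m$ or one of the summands is $\infty$. ''Multiplication by $n^j$'' is the map $E_{n^k}\to E_{n^s}$ sending $x\in\{0,\ldots,n^k\}$ to the $n^jx$-fold sum of $1\in E_{n^s}$, and $\infty$ to $\infty$ ($j\in\mathbb{N}$); only those maps of this form that are order-embeddings are morphisms of $\mathfrak{e}_n$. **Properties.** An ideal of $S$ is a submonoid that is downward-hereditary and closed under suprema of increasing sequences; $S$ is simple if its only ideals are $\{0\}$ and $S$. $S$ is stably finite if $x\ne x+y$ for every nonzero $y\in S$ whenever $x\ll z$ for some $z\in S$. $S$ is $m$-weakly purely infinite if $mx=2(mx)$ for every $x\in S$, and weakly purely infinite if it is $m$-weakly purely infinite for some $m\ge1$. **Finite-set comparison.** For $\mathrm{Cu}$-morphisms $\alpha,\beta\colon S\to T$ and a finite set $F\subseteq S$, write $\alpha\simeq_F\beta$ if $\alpha(x')\le\beta(x)$ and $\beta(x')\le\alpha(x)$ for all $x',x\in F$ with $x'\ll x$. **Fraïssé limit.** An inductive sequence $(S_i,\sigma_{i,j})_{i\in\mathbb{N}}$ in a subcategory $\mathfrak{c}\subseteq\mathrm{Cu}$ is a Fraïssé sequence if every $S_i$ is countably-based and, for every $i$, every finite $F\subseteq S_i$ and every $\mathfrak{c}$-morphism $\alpha\colon S_i\to C$, there are $j\ge i$ and a $\mathfrak{c}$-morphism $\beta_F\colon C\to S_j$ with $\beta_F\circ\alpha\simeq_F\sigma_{i,j}$. The category $\mathfrak{e}_n$ is a Fraïssé category, so it has a Fraïssé sequence; the Fraïssé limit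 is the $\mathrm{Cu}$-limit of any Fraïssé sequence (unique up to isomorphism).
   Formalization: ''Not weakly purely infinite'' is proved only for n ≥ 2; for n = 1 it fails, since the Fraïssé limit is then E_1 = {0,1,∞}, where 2x = 4x for every x. The other properties are proved for all n ≥ 1. *)

(* Defs.v *)
From HB Require Import structures.
From mathcomp Require Import all_boot all_order all_algebra.
From mathcomp Require Import boolp classical_sets cardinality.

Set Implicit Arguments.
Unset Strict Implicit.
Unset Printing Implicit Defensive.

Import Order.TTheory GRing.Theory.
Local Open Scope classical_set_scope.
Local Open Scope ring_scope.

(* MathComp's hierarchy does not allow a new join of [nmodType] and [porderType]
   below [porderZmodType], hence the order is part of this mixin. *)
HB.mixin Record isPositivelyOrdered S of GRing.Nmodule S := {
  cu_le : S -> S -> Prop;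
  cu_le_refl : forall x : S, cu_le x x;
  cu_le_anti : forall x y : S, cu_le x y -> cu_le y x -> x = y;
  cu_le_trans : forall y x z : S, cu_le x y -> cu_le y z -> cu_le x z;
  cu_le0 : forall x : S, cu_le 0 x;
  cu_leD : forall x y z : S, cu_le x y -> cu_le (x + z) (y + z)
}.

#[short(type="poMonoidType")]
HB.structure Definition POMonoid :=
  {S of isPositivelyOrdered S & GRing.Nmodule S}.

Notation "x <=: y" := (cu_le x y) (at level 70, no associativity) : ring_scope.

Section Order.
Context {S : poMonoidType}.

Definition cu_increasing (z : nat -> S) : Prop :=
  forall i j : nat, (i <= j)%N -> z i <=: z j.

Definition is_sup_seq (z : nat -> S) (s : S) : Prop :=
  (forall i, z i <=: s) /\ (forall b, (forall i, z i <=: b) -> s <=: b).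

Definition way_below (x y : S) : Prop :=
  forall z s, cu_increasing z -> is_sup_seq z s -> y <=: s ->
    exists i, x <=: z i.

Definition cu_way_increasing (z : nat -> S) : Prop :=
  forall i, way_below (z i) (z i.+1).

End Order.

Notation "x `<< y" := (way_below x y)
  (at level 70, no associativity) : ring_scope.

HB.mixin Record isCu S of POMonoid S := {
  cuO1 : forall z : nat -> S, cu_increasing z -> exists s, is_sup_seq z s;
  cuO2 : forall x : S, exists2 z : nat -> S, cu_way_increasing z & is_sup_seq z x;
  cuO3 : forall x' x y' y : S, x' `<< x -> y' `<< y -> x' + y' `<< x + y;
  cuO4 : forall (u v : nat -> S) (x y : S),
    cu_increasing u -> cu_increasing v -> is_sup_seq u x -> is_sup_seq v y ->
    is_sup_seq (fun i => u i + v i) (x + y)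
}.

#[short(type="cuType")]
HB.structure Definition CuSemigroup := {S of isCu S & POMonoid S}.

Record cu_morphism (S T : cuType) (f : S -> T) : Prop := CuMorphism {
  cu_mor0 : f 0 = 0;
  cu_morD : {morph f : x y / x + y};
  cu_mor_le : forall x y, x <=: y -> f x <=: f y;
  cu_mor_way : forall x y, x `<< y -> f x `<< f y;
  cu_mor_sup : forall z s,
    cu_increasing z -> is_sup_seq z s -> is_sup_seq (f \o z) (f s)
}.

Definition order_embedding (S T : cuType) (f : S -> T) : Prop :=
  cu_morphism f /\ forall x y, f x <=: f y -> x <=: y.

Definition countably_based (S : cuType) : Prop :=
  exists2 B : set S, countable B &
    forall x : S, exists z : nat -> S,
      [/\ forall i, B (z i), cu_way_increasing z & is_sup_seq z x].

Record cu_ideal (S : cuType) (I : set S) : Prop := CuIdeal {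
  cu_ideal0 : I 0;
  cu_idealD : forall x y, I x -> I y -> I (x + y);
  cu_ideal_le : forall x y, x <=: y -> I y -> I x;
  cu_ideal_sup : forall z s,
    cu_increasing z -> (forall i, I (z i)) -> is_sup_seq z s -> I s
}.

Definition cu_simple (S : cuType) : Prop :=
  forall I : set S, cu_ideal I -> I = [set 0] \/ I = setT.

Definition stably_finite (S : cuType) : Prop :=
  forall x : S, (exists z : S, x `<< z) -> forall y : S, y <> 0 -> x <> x + y.

Definition m_weakly_purely_infinite (m : nat) (S : cuType) : Prop :=
  forall x : S, x *+ m = (x *+ m) *+ 2.

Definition weakly_purely_infinite (S : cuType) : Prop :=
  exists2 m : nat, (1 <= m)%N & m_weakly_purely_infinite m S.

Definition approx_on (S T : cuType) (F : set S) (f g : S -> T) : Prop :=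
  forall x' x, F x' -> F x -> x' `<< x -> f x' <=: g x /\ g x' <=: f x.

(* A subcategory of Cu: its objects are the members of a family of
   Cu-semigroups, its morphisms a class of Cu-morphisms between them closed
   under identities and composition. *)
Record cu_subcategory := CuSubcategory {
  sc_index : Type;
  sc_obj : sc_index -> cuType;
  sc_hom : forall a b, (sc_obj a -> sc_obj b) -> Prop;
  sc_hom_cu : forall a b (f : sc_obj a -> sc_obj b), sc_hom f -> cu_morphism f;
  sc_hom_id : forall a, sc_hom (@id (sc_obj a));
  sc_hom_comp : forall a b c (g : sc_obj b -> sc_obj c) (f : sc_obj a -> sc_obj b),
    sc_hom g -> sc_hom f -> sc_hom (g \o f)
}.

(* The connecting maps are only constrained for [i <= j]; the values of
   [sigma i j] for [j < i] are irrelevant. *)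
Record inductive_sequence (S : nat -> cuType)
    (sigma : forall i j, S i -> S j) : Prop := InductiveSequence {
  ind_cu : forall i j, (i <= j)%N -> cu_morphism (@sigma i j);
  ind_id : forall i, @sigma i i =1 id;
  ind_comp : forall i j k, (i <= j)%N -> (j <= k)%N ->
    @sigma j k \o @sigma i j =1 @sigma i k
}.

Definition cu_cocone (S : nat -> cuType) (sigma : forall i j, S i -> S j)
    (T : cuType) (phi : forall i, S i -> T) : Prop :=
  (forall i, cu_morphism (@phi i)) /\
  (forall i j, (i <= j)%N -> @phi j \o @sigma i j =1 @phi i).

Definition is_cu_limit (S : nat -> cuType) (sigma : forall i j, S i -> S j)
    (L : cuType) (phi : forall i, S i -> L) : Prop :=
  cu_cocone sigma phi /\
  forall (T : cuType) (psi : forall i, S i -> T), cu_cocone sigma psi ->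
    exists h : L -> T,
      [/\ cu_morphism h, forall i, h \o @phi i =1 @psi i &
          forall h' : L -> T, cu_morphism h' ->
            (forall i, h' \o @phi i =1 @psi i) -> h' =1 h].

Record fraisse_sequence (C : cu_subcategory) (a : nat -> sc_index C)
    (sigma : forall i j, sc_obj (a i) -> sc_obj (a j)) : Prop :=
  FraisseSequence {
  fr_ind : inductive_sequence sigma;
  fr_hom : forall i j, (i <= j)%N -> sc_hom (@sigma i j);
  fr_countable : forall i, countably_based (sc_obj (a i));
  fr_absorb : forall i (F : set (sc_obj (a i))) (c : sc_index C)
      (alpha : sc_obj (a i) -> sc_obj c),
    finite_set F -> sc_hom alpha ->
    exists j, (i <= j)%N /\
      exists beta : sc_obj c -> sc_obj (a j),
        sc_hom beta /\ approx_on F (beta \o alpha) (@sigma i j)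
}.

Definition is_fraisse_limit (C : cu_subcategory) (L : cuType) : Prop :=
  exists (a : nat -> sc_index C)
         (sigma : forall i j, sc_obj (a i) -> sc_obj (a j))
         (phi : forall i, sc_obj (a i) -> L),
    fraisse_sequence sigma /\ is_cu_limit sigma phi.

(* E_m = {0, 1, ..., m, oo}, with [Some i] standing for i and [None] for oo. *)
Definition elementary (m : nat) : Type := option 'I_m.+1.

Section Elementary.
Variable m : nat.
Local Notation E := (elementary m).

Definition elem_le (x y : E) : bool :=
  match x, y with
  | _, None => true
  | None, Some _ => false
  | Some i, Some j => (i <= j)%N
  end.

(* [insub k] is [Some k] if k <= m and [None] otherwise. *)
Definition elem_add (x y : E) : E :=
  match x, y with
  | Some i, Some j => insub (i + j)%N
  | _, _ => None
  end.

Definition elem_zero : E := Some ord0.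

Let rank (x : E) : nat := if x is Some i then i else m.+1.

Let rank_le x : (rank x <= m.+1)%N.
Proof. by case: x => [i|] //=; apply: ltnW. Qed.

Let rank_inj : injective rank.
Proof.
move=> [i|] [j|] //= h; first by congr Some; apply: val_inj.
- by have := ltn_ord i; rewrite h ltnn.
- by have := ltn_ord j; rewrite -h ltnn.
Qed.

Let leE x y : elem_le x y = (rank x <= rank y)%N.
Proof.
case: x => [i|]; case: y => [j|] //=; last by rewrite leqnn.
- by rewrite ltnW.
- by rewrite leqNgt ltn_ord.
Qed.

Let rank_insub k : rank (insub k) = minn k m.+1.
Proof.
rewrite /rank; case: insubP => [i _ <-|]; first by rewrite (minn_idPl (ltnW (ltn_ord i))).
by rewrite -leqNgt => /minn_idPr.
Qed.

Let rankD x y : rank (elem_add x y) = minn (rank x + rank y) m.+1.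
Proof.
case: x => [i|] /=; last by rewrite (minn_idPr _) ?leq_addr.
case: y => [j|] /=; last by rewrite (minn_idPr _) ?leq_addl.
by rewrite rank_insub.
Qed.

Let addA : associative elem_add.
Proof.
have minDl a b : minn (minn a m.+1 + b) m.+1 = minn (a + b) m.+1.
  case: (leqP a m.+1) => // h.
  by rewrite !(minn_idPr _) // ?leq_addr// (leq_trans (ltnW h))// leq_addr.
move=> x y z; apply: rank_inj; rewrite !rankD minDl.
by rewrite addnC minDl addnC addnA.
Qed.

Let addC : commutative elem_add.
Proof. by move=> x y; apply: rank_inj; rewrite !rankD addnC. Qed.

Let add0 : left_id elem_zero elem_add.
Proof.
by move=> x; apply: rank_inj; rewrite rankD add0n; apply/minn_idPl/rank_le.
Qed.

HB.instance Definition _ := Choice.on E.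
HB.instance Definition _ := GRing.isNmodule.Build E addA addC add0.

Let rankDr (x y : E) : rank (x + y) = minn (rank x + rank y) m.+1.
Proof. exact: rankD. Qed.

Let le_refl (x : E) : elem_le x x.
Proof. by rewrite leE. Qed.

Let le_anti (x y : E) : elem_le x y -> elem_le y x -> x = y.
Proof.
by rewrite !leE => xy yx; apply/rank_inj/eqP; rewrite eqn_leq xy yx.
Qed.

Let le_trans (y x z : E) : elem_le x y -> elem_le y z -> elem_le x z.
Proof. by rewrite !leE; apply: leq_trans. Qed.

Let le0 (x : E) : elem_le 0 x.
Proof. by rewrite leE. Qed.

Let leD (x y z : E) : elem_le x y -> elem_le (x + z) (y + z).
Proof.
rewrite !leE !rankDr => h.
by rewrite leq_min geq_minr andbT geq_min leq_add2r h.
Qed.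

HB.instance Definition _ :=
  isPositivelyOrdered.Build E le_refl le_anti le_trans le0 leD.

Let sup_attained (z : nat -> E) : exists i, forall j, z j <=: z i.
Proof.
have [k [i hi] kmax] : exists2 k, (exists i, rank (z i) = k) &
    forall j, (rank (z j) <= k)%N.
  have ex : exists k, `[<exists i, rank (z i) = k>].
    by exists (rank (z 0%N)); apply/asboolP; exists 0%N.
  have ub k : `[<exists i, rank (z i) = k>] -> (k <= m.+1)%N.
    by move=> /asboolP [i <-]; apply: rank_le.
  case: (ex_maxnP ex ub) => k /asboolP hk kmax; exists k => // j.
  by apply: kmax; apply/asboolP; exists j.
by exists i => j; rewrite /cu_le /= leE hi.
Qed.

Let sup_eq (z : nat -> E) s :
  is_sup_seq z s -> exists2 i, z i = s & forall j, z j <=: z i.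
Proof.
move=> [ub lub]; have [i hi] := sup_attained z; exists i => //.
by apply: cu_le_anti; [apply: ub | apply: lub].
Qed.

Let max_sup (z : nat -> E) i : (forall j, z j <=: z i) -> is_sup_seq z (z i).
Proof. by move=> h; split=> // b; apply. Qed.

Let compact (x y : E) : x <=: y -> x `<< y.
Proof.
move=> xy z s hz hs ys; have [i zi _] := sup_eq hs.
by exists i; rewrite zi; apply: cu_le_trans xy ys.
Qed.

Let way_le (x y : E) : x `<< y -> x <=: y.
Proof.
have refl (i j : nat) : (fun=> y) i <=: (fun=> y) j by exact: cu_le_refl.
move=> /(_ (fun=> y) y); case=> [i j _|||//]; first exact: refl.
  by apply: (@max_sup _ 0%N) => j; exact: refl.
exact: cu_le_refl.
Qed.

Let O1 (z : nat -> E) : cu_increasing z -> exists s, is_sup_seq z s.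
Proof. by have [i hi] := sup_attained z; exists (z i); apply: max_sup. Qed.

Let O2 (x : E) : exists2 z : nat -> E, cu_way_increasing z & is_sup_seq z x.
Proof.
exists (fun=> x); first by move=> i; apply: compact; exact: cu_le_refl.
by apply: (@max_sup _ 0%N) => _; exact: cu_le_refl.
Qed.

Let leD2 (x y z t : E) : x <=: y -> z <=: t -> x + z <=: y + t.
Proof.
move=> xy zt; apply: cu_le_trans (cu_leD x y z xy) _.
by rewrite ![y + _]GRing.addrC; apply: cu_leD.
Qed.

Let O3 (x' x y' y : E) : x' `<< x -> y' `<< y -> x' + y' `<< x + y.
Proof. by move=> /way_le hx /way_le hy; apply: compact; apply: leD2. Qed.

Let O4 (u v : nat -> E) (x y : E) :
  cu_increasing u -> cu_increasing v -> is_sup_seq u x -> is_sup_seq v y ->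
  is_sup_seq (fun i => u i + v i) (x + y).
Proof.
move=> hu hv hx hy; have [i <- iM] := sup_eq hx.
have [j <- jM] := sup_eq hy; split=> [k|b hb]; first exact: leD2.
apply: cu_le_trans (hb (maxn i j)).
by apply: leD2; [apply/hu/leq_maxl | apply/hv/leq_maxr].
Qed.

HB.instance Definition _ := isCu.Build E O1 O2 O3 O4.

Definition elem_one : E := insub 1%N.

Lemma elem_mulrn (k : nat) : elem_one *+ k = insub k :> E.
Proof.
apply: rank_inj; elim: k => [|k IH].
  by rewrite mulr0n rank_insub min0n.
rewrite mulrSr rankDr IH !rank_insub.
case: (leqP k.+1 m.+1) => hk.
  by rewrite (minn_idPl (ltnW hk)) (minn_idPl (ltn0Sn m)) addn1 (minn_idPl hk).
by apply/minn_idPr; rewrite (minn_idPr _) //; exact: leq_addr.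
Qed.

End Elementary.

Definition elem_mul (n j k s : nat) (x : elementary (n ^ k)) :
    elementary (n ^ s) :=
  if x is Some i then elem_one (n ^ s) *+ (n ^ j * i) else None.

Definition en_obj (n k : nat) : cuType := elementary (n ^ k).

Definition en_hom (n k s : nat) (f : en_obj n k -> en_obj n s) : Prop :=
  order_embedding f /\ exists j : nat, f =1 @elem_mul n j k s.

Lemma order_embedding_id (S : cuType) : order_embedding (@id S).
Proof. by split=> //; split. Qed.

Lemma cu_morphism_comp (S T U : cuType) (g : T -> U) (f : S -> T) :
  cu_morphism g -> cu_morphism f -> cu_morphism (g \o f).
Proof.
move=> hg hf; split=> [|x y|x y h|x y h|z s hz hs] /=.
- by rewrite (cu_mor0 hf) (cu_mor0 hg).
- by rewrite (cu_morD hf) (cu_morD hg).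
- exact/(cu_mor_le hg)/(cu_mor_le hf).
- exact/(cu_mor_way hg)/(cu_mor_way hf).
- apply: (cu_mor_sup hg (z := f \o z)); last exact: cu_mor_sup hf _ _ hz hs.
  by move=> i j ij; apply/(cu_mor_le hf)/hz.
Qed.

Lemma order_embedding_comp (S T U : cuType) (g : T -> U) (f : S -> T) :
  order_embedding g -> order_embedding f -> order_embedding (g \o f).
Proof.
move=> [hg eg] [hf ef]; split; first exact: cu_morphism_comp.
by move=> x y /eg /ef.
Qed.

Lemma en_hom_cu (n k s : nat) (f : en_obj n k -> en_obj n s) :
  en_hom f -> cu_morphism f.
Proof. by move=> [[]]. Qed.

Lemma en_hom_id (n k : nat) : en_hom (@id (en_obj n k)).
Proof.
split; first exact: order_embedding_id.
exists 0%N => -[i|] //=; rewrite expn0 mul1n elem_mulrn.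
by case: insubP => [u _ uE|/negP[]]; [congr Some; apply: val_inj|].
Qed.

Lemma en_hom_comp (n : nat) (n_gt0 : (1 <= n)%N) (k s t : nat)
    (g : en_obj n s -> en_obj n t) (f : en_obj n k -> en_obj n s) :
  en_hom g -> en_hom f -> en_hom (g \o f).
Proof.
move=> [hg [j gE]] [hf [i fE]]; split; first exact: order_embedding_comp.
exists (j + i)%N => x /=; rewrite fE; case: x => [x|] /=; last by rewrite gE.
have gMn y a : g (y *+ a) = g y *+ a.
  elim: a => [|a IH]; first by rewrite !mulr0n (cu_mor0 hg.1).
  by rewrite !mulrS (cu_morD hg.1) IH.
rewrite gMn gE /elem_one.
case: insubP => [u _ /= ->|]; last by rewrite ltnS expn_gt0 n_gt0.
by rewrite muln1 -mulrnA mulnA expnD.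
Qed.

Definition en (n : nat) (n_gt0 : (1 <= n)%N) : cu_subcategory :=
  CuSubcategory (@en_hom_cu n) (@en_hom_id n) (@en_hom_comp n n_gt0).

(* Main.v *)
(** The connecting maps are order-embeddings, and every element of an
    elementary semigroup is compact. The algebraic direct limit of the sequence
    is thus a countable preordered monoid of compact elements, and its completion
    T by ideals (directed lower sets) is a Cu-semigroup in which every element is
    a supremum of images of the building blocks. The universal property of the
    limit L gives L -> T, which shows that the structure maps into L are
    order-embeddings. Monotone extension gives T -> L with composite the identity
    of L, which shows that L is generated under suprema by the images of the
    building blocks.

    Totality of the order then passes from the blocks to L. A nonzero element of
    L dominates the image of a nonzero x in some E_m, and (m+1)x = oo is the top
    element of L, whence simplicity; oo is compact and absorbing, so L is not
    stably finite. For n >= 2 the sequence reaches arbitrarily large n^k, and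
    m.1 <> 2m.1 in E_{n^k} as soon as 2m <= n^k. *)

From HB Require Import structures.
Require Import Defs.
From mathcomp Require Import all_boot all_algebra.
From mathcomp Require Import boolp classical_sets cardinality.

Set Implicit Arguments.
Unset Strict Implicit.
Unset Printing Implicit Defensive.

Import GRing.Theory.
Local Open Scope classical_set_scope.
Local Open Scope ring_scope.

(** * The way-below relation and general facts on Cu-morphisms *)

Section CuBasics.
Context {S : poMonoidType}.
Implicit Types x y : S.

Lemma cu_leD2 x y z t : x <=: y -> z <=: t -> x + z <=: y + t.
Proof.
move=> xy zt; apply: cu_le_trans (cu_leD x y z xy) _.
by rewrite ![y + _]addrC; apply: cu_leD.
Qed.

Lemma is_sup_seq_cst x : is_sup_seq (fun=> x) x.
Proof. by split=> [_|b]; [exact: cu_le_refl | apply; exact: 0%N]. Qed.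

Lemma way_below_le x y : x `<< y -> x <=: y.
Proof.
move=> /(_ (fun=> y) y); case=> //; last exact: cu_le_refl.
- by move=> *; exact: cu_le_refl.
- exact: is_sup_seq_cst.
Qed.

Lemma way_below_trans_le x' x y y' :
  x' <=: x -> x `<< y -> y <=: y' -> x' `<< y'.
Proof.
move=> x'x xy yy' z s hz hs y's.
have [i xz] := xy z s hz hs (cu_le_trans _ _ _ yy' y's).
by exists i; apply: cu_le_trans x'x xz.
Qed.

End CuBasics.

Lemma cu_morphism_id (S : cuType) : cu_morphism (@id S).
Proof. by case: (order_embedding_id S). Qed.

(** When all elements of the source are compact, an increasing sequence attains its supremum, so
    suprema are preserved by monotonicity alone. Way-below is preserved because the images are
    compact as well. *)
Lemma compact_cu_morphism (S T : cuType) (f : S -> T) :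
  (forall x : S, x `<< x) -> f 0 = 0 -> {morph f : x y / x + y} ->
  (forall x y, x <=: y -> f x <=: f y) -> (forall x, f x `<< f x) ->
  cu_morphism f.
Proof.
move=> cS f0 fD fle cf; split=> // [x y /way_below_le /fle xy|z s incz supz].
  exact: way_below_trans_le (cu_le_refl _) (cf x) xy.
have [k sz] := cS s z s incz supz (cu_le_refl s).
split=> [j|b ub]; first exact/fle/supz.1.
exact: cu_le_trans (fle _ _ sz) (ub k).
Qed.

Lemma cu_morMn (S T : cuType) (f : S -> T) (x : S) (k : nat) :
  cu_morphism f -> f (x *+ k) = f x *+ k.
Proof.
move=> fcu; elim: k => [|k IH]; first by rewrite !mulr0n (cu_mor0 fcu).
by rewrite !mulrS (cu_morD fcu) IH.
Qed.

Lemma cu_idealMn (S : cuType) (I : set S) (x : S) (k : nat) :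
  cu_ideal I -> I x -> I (x *+ k).
Proof.
move=> idI Ix; elim: k => [|k IH]; first by rewrite mulr0n; exact: cu_ideal0 idI.
by rewrite mulrS; exact: cu_idealD idI _ _ Ix IH.
Qed.

(** * Ideal completion of a countable preordered monoid *)

(* The monoid laws are only required up to the equivalence induced by the
   preorder; passing to ideals quotients by it. *)
Record premonoid := Premonoid {
  pm_sort :> Type;
  pm_le : pm_sort -> pm_sort -> Prop;
  pm_add : pm_sort -> pm_sort -> pm_sort;
  pm_zero : pm_sort;
  pm_countable : countable [set: pm_sort];
  pm_le_refl : forall x, pm_le x x;
  pm_le_trans : forall y x z, pm_le x y -> pm_le y z -> pm_le x z;
  pm_le0 : forall x, pm_le pm_zero x;
  pm_leD2 : forall x y z t, pm_le x y -> pm_le z t ->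
    pm_le (pm_add x z) (pm_add y t);
  pm_addC : forall x y, pm_le (pm_add x y) (pm_add y x);
  pm_addA : forall x y z,
    pm_le (pm_add x (pm_add y z)) (pm_add (pm_add x y) z);
  pm_add0_le : forall x, pm_le (pm_add pm_zero x) x;
  pm_le_add0 : forall x, pm_le x (pm_add pm_zero x)
}.
Arguments pm_zero {p}.
Arguments pm_le_trans {p}.

Section PremonoidTheory.
Variable P : premonoid.
Implicit Types x y z : P.

Lemma pm_addAr x y z :
  pm_le (pm_add (pm_add x y) z) (pm_add x (pm_add y z)).
Proof.
apply: pm_le_trans (pm_addC _ _) _; apply: pm_le_trans (pm_addA _ _ _) _.
apply: pm_le_trans (pm_addC _ _) _; apply: pm_le_trans (pm_addA _ _ _) _.
exact: pm_addC.
Qed.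

End PremonoidTheory.

(** These are order ideals, not to be confused with [cu_ideal]. Nonemptiness is stated as membership
    of [pm_zero], which is equivalent for a lower set because zero is least. *)
Record ideal_completion (P : premonoid) := IdealCompletion {
  ideal_set :> P -> Prop;
  ideal_zero : ideal_set pm_zero;
  ideal_lower : forall x y, pm_le x y -> ideal_set y -> ideal_set x;
  ideal_directed : forall x y, ideal_set x -> ideal_set y ->
    exists2 z, ideal_set z & pm_le x z /\ pm_le y z
}.

Section IdealCompletion.
Variable P : premonoid.
Local Notation T := (ideal_completion P).
Implicit Types (D : T) (x y z : P).

Definition ideal_le D D' : Prop := forall x, D x -> D' x.

Lemma ideal_eq D D' : ideal_le D D' -> ideal_le D' D -> D = D'.
Proof.
move=> DD' D'D; have : ideal_set D = ideal_set D'.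
  by apply/funext => x; apply/propext; split; [exact: DD' | exact: D'D].
case: D D' {DD' D'D} => [D d0 d1 d2] [D' d0' d1' d2'] /= E.
by move: d0' d1' d2'; rewrite -E => *; congr IdealCompletion; exact: Prop_irrelevance.
Qed.

(** Only the underlying set is specified; [principal] is then picked by choice, which keeps the
    proof fields out of later computations. [ideal_add] follows the same pattern. *)
Lemma principal_subproof x :
  exists D : T, ideal_set D = [set y | pm_le y x].
Proof.
unshelve eexists.
  exists [set y | pm_le y x]; first exact: pm_le0.
    by move=> y z yz zx; apply: pm_le_trans yz zx.
  by move=> y z yx zx; exists x => //; exact: pm_le_refl.
by [].
Qed.

Definition principal x : T := sval (cid (principal_subproof x)).

Lemma principalE x y : principal x y <-> pm_le y x.
Proof. by rewrite /principal; case: cid => D /= ->. Qed.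

Lemma principal_mem x : principal x x.
Proof. exact/principalE/pm_le_refl. Qed.

Lemma principal_sub D x : D x -> ideal_le (principal x) D.
Proof. by move=> Dx y /principalE yx; apply: ideal_lower yx Dx. Qed.

Lemma ideal_add_subproof D D' : exists D'' : T,
  ideal_set D'' = [set z | exists x y, [/\ D x, D' y & pm_le z (pm_add x y)]].
Proof.
unshelve eexists.
  exists [set z | exists x y, [/\ D x, D' y & pm_le z (pm_add x y)]].
  - by exists pm_zero, pm_zero; split; [exact: ideal_zero.. | exact: pm_le0].
  - move=> z t zt [x [y [Dx Dy tle]]].
    by exists x, y; split=> //; apply: pm_le_trans zt tle.
  - move=> z t [x [y [Dx Dy zle]]] [x' [y' [Dx' Dy' tle]]].
    have [a Da [xa x'a]] := ideal_directed Dx Dx'.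
    have [b Db [yb y'b]] := ideal_directed Dy Dy'.
    exists (pm_add a b); first by exists a, b; split=> //; exact: pm_le_refl.
    by split; [apply: pm_le_trans zle _ | apply: pm_le_trans tle _];
      apply: pm_leD2.
by [].
Qed.

Definition ideal_add D D' : T := sval (cid (ideal_add_subproof D D')).

Lemma ideal_addE D D' z :
  ideal_add D D' z <-> exists x y, [/\ D x, D' y & pm_le z (pm_add x y)].
Proof. by rewrite /ideal_add; case: cid => D'' /= ->. Qed.

Let addC : commutative ideal_add.
Proof.
suff sub D D' : ideal_le (ideal_add D D') (ideal_add D' D).
  by move=> D D'; apply: ideal_eq.
move=> z /ideal_addE [x [y [Dx Dy zle]]]; apply/ideal_addE.
by exists y, x; split=> //; apply: pm_le_trans zle (pm_addC _ _).
Qed.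

Let addA : associative ideal_add.
Proof.
move=> D1 D2 D3; apply: ideal_eq => t.
- move=> /ideal_addE [x [w [Dx /ideal_addE [y [z [Dy Dz wle]]] tle]]].
  apply/ideal_addE; exists (pm_add x y), z; split=> //.
    by apply/ideal_addE; exists x, y; split=> //; exact: pm_le_refl.
  apply: pm_le_trans tle (pm_le_trans _ _ _ _ (pm_addA _ _ _)).
  by apply: pm_leD2 => //; exact: pm_le_refl.
- move=> /ideal_addE [w [z [/ideal_addE [x [y [Dx Dy wle]]] Dz tle]]].
  apply/ideal_addE; exists x, (pm_add y z); split=> //.
    by apply/ideal_addE; exists y, z; split=> //; exact: pm_le_refl.
  apply: pm_le_trans tle (pm_le_trans _ _ _ _ (pm_addAr _ _ _)).
  by apply: pm_leD2 => //; exact: pm_le_refl.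
Qed.

Let add0 : left_id (principal pm_zero) ideal_add.
Proof.
move=> D; apply: ideal_eq => z.
- move=> /ideal_addE [x [y [/principalE x0 Dy zle]]].
  apply: ideal_lower Dy; apply: pm_le_trans zle (pm_le_trans _ _ _ _ (pm_add0_le _)).
  by apply: pm_leD2 => //; exact: pm_le_refl.
- move=> Dz; apply/ideal_addE; exists pm_zero, z.
  by split=> //; [exact: principal_mem | exact: pm_le_add0].
Qed.

HB.instance Definition _ := gen_eqMixin T.
HB.instance Definition _ := gen_choiceMixin T.
HB.instance Definition _ := GRing.isNmodule.Build T addA addC add0.

Let leD (D1 D2 D3 : T) : ideal_le D1 D2 -> ideal_le (D1 + D3) (D2 + D3).
Proof.
move=> sub z /ideal_addE [x [y [Dx Dy zle]]]; apply/ideal_addE.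
by exists x, y; split=> //; exact: sub.
Qed.

Let le_refl D : ideal_le D D. Proof. by []. Qed.

Let le_trans (D2 D1 D3 : T) : ideal_le D1 D2 -> ideal_le D2 D3 -> ideal_le D1 D3.
Proof. by move=> D12 D23 x /D12 /D23. Qed.

Let le0 D : ideal_le 0 D.
Proof. exact/principal_sub/ideal_zero. Qed.

HB.instance Definition _ :=
  isPositivelyOrdered.Build T le_refl ideal_eq le_trans le0 leD.

Lemma ideal_bigcup_subproof (Z : nat -> T) : cu_increasing Z ->
  exists D : T, ideal_set D = [set x | exists i, Z i x].
Proof.
move=> incZ; unshelve eexists.
  exists [set x | exists i, Z i x].
  - by exists 0%N; exact: ideal_zero.
  - by move=> x y xy [i Zy]; exists i; apply: ideal_lower xy Zy.
  - move=> x y [i Zx] [j Zy].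
    have Zx' := incZ _ _ (leq_maxl i j) _ Zx.
    have Zy' := incZ _ _ (leq_maxr i j) _ Zy.
    by have [z Zz zle] := ideal_directed Zx' Zy'; exists z => //; exists (maxn i j).
by [].
Qed.

Lemma bigcup_is_sup (Z : nat -> T) D :
  ideal_set D = [set x | exists i, Z i x] -> is_sup_seq Z D.
Proof.
move=> DE; split=> [i x Zx|B ub x]; rewrite /= DE; first by exists i.
by move=> [i]; exact: ub.
Qed.

(** The union of an increasing sequence is again directed, hence an ideal and an upper bound, so the
    supremum lies below it. *)
Lemma ideal_supE (Z : nat -> T) D : cu_increasing Z -> is_sup_seq Z D ->
  forall x, D x <-> exists i, Z i x.
Proof.
move=> incZ [ubD lubD] x; split; last by move=> [i /ubD].
have [D' D'E] := ideal_bigcup_subproof incZ.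
have [ubD' _] := bigcup_is_sup D'E.
by move=> /(lubD _ ubD'); rewrite D'E.
Qed.

(** The elements of [P] carry injective codes; the step from [k] to [k.+1] moves the chain above the
    element of [D] with code [k], if there is one. *)
Lemma ideal_cofinal D : exists u : nat -> P,
  [/\ forall i, D (u i), forall i j, (i <= j)%N -> pm_le (u i) (u j)
    & forall x, D x -> exists i, pm_le x (u i)].
Proof.
have /countable_injP [c cinj] := pm_countable P.
have step (p : nat * P) : exists q, D p.2 ->
    [/\ D q, pm_le p.2 q & forall x, D x -> c x = p.1 -> pm_le x q].
  (* Choice asks for a value at every pair; outside [D] the current element is kept. *)
  have [Dp|nDp] := pselect (D p.2); last by exists p.2.
  have [[x [Dx cx]]|nx] := pselect (exists x, D x /\ c x = p.1).
    have [q Dq [pq xq]] := ideal_directed Dp Dx; exists q => _; split=> //.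
    move=> y Dy cy; suff -> : y = x by [].
    by apply: cinj; rewrite ?inE ?cy ?cx.
  exists p.2 => _; split=> //; first exact: pm_le_refl.
  by move=> x Dx cx; case: nx; exists x.
have [F FP] := choice step.
pose u := fix u k := if k is k'.+1 then F (k', u k') else pm_zero.
have Du k : D (u k).
  elim: k => [|k IH] /=; first exact: ideal_zero.
  by have [] := FP (k, u k) IH.
exists u; split=> //.
- move=> i j /subnK <-; elim: (j - i)%N => [|k IH]; first exact: pm_le_refl.
  apply: pm_le_trans IH _.
  by have [] := FP ((k + i)%N, u (k + i)%N) (Du _).
- move=> x Dx; exists (c x).+1.
  by have [_ _ h] := FP (c x, u (c x)) (Du _); exact: h.
Qed.

Lemma principal_mono x y : pm_le x y -> principal x <=: principal y.
Proof.
by move=> xy z /principalE zx; apply/principalE; apply: pm_le_trans zx xy.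
Qed.

Lemma cofinal_is_sup D (u : nat -> P) : (forall i, D (u i)) ->
  (forall x, D x -> exists i, pm_le x (u i)) ->
  is_sup_seq (fun i => principal (u i)) D.
Proof.
move=> Du cof; split=> [i|B ub x Dx]; first exact: principal_sub.
by have [i xu] := cof x Dx; apply: (ub i); apply/principalE.
Qed.

(** A chain cofinal in [D] makes [D] a supremum of principal ideals, one of which must contain [D'].
    Conversely, suprema are unions, so [x] already belongs to some term of the sequence. *)
Lemma ideal_wayP (D' D : T) :
  D' `<< D <-> exists2 x, D x & D' <=: principal x.
Proof.
split=> [way|[x Dx D'x] Z s incZ supZ Ds].
- have [u [Du incu cof]] := ideal_cofinal D.
  have [i D'u] := way _ _ (fun i j ij => principal_mono (incu i j ij))
    (cofinal_is_sup Du cof) (cu_le_refl _).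
  by exists (u i).
- have /(ideal_supE incZ supZ)[i Zx] : s x by exact: Ds.
  by exists i; apply: cu_le_trans D'x _; exact: principal_sub.
Qed.

Let O1 (Z : nat -> T) : cu_increasing Z -> exists s, is_sup_seq Z s.
Proof.
by move=> /ideal_bigcup_subproof [D DE]; exists D; exact: bigcup_is_sup.
Qed.

Let O2 D : exists2 Z : nat -> T, cu_way_increasing Z & is_sup_seq Z D.
Proof.
have [u [Du incu cof]] := ideal_cofinal D.
exists (fun i => principal (u i)); last exact: cofinal_is_sup.
move=> i; apply/ideal_wayP; exists (u i); last exact: cu_le_refl.
by apply/principalE/incu.
Qed.

Let O3 (x' x y' y : T) : x' `<< x -> y' `<< y -> x' + y' `<< x + y.
Proof.
move=> /ideal_wayP [a xa x'a] /ideal_wayP [b yb y'b].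
apply/ideal_wayP; exists (pm_add a b).
  by apply/ideal_addE; exists a, b; split=> //; exact: pm_le_refl.
move=> z /ideal_addE [c [d [x'c y'd zle]]]; apply/principalE.
apply: pm_le_trans zle _.
by apply: pm_leD2; apply/principalE; [exact: x'a | exact: y'b].
Qed.

Let O4 (U V : nat -> T) (x y : T) :
  cu_increasing U -> cu_increasing V -> is_sup_seq U x -> is_sup_seq V y ->
  is_sup_seq (fun i => U i + V i) (x + y).
Proof.
move=> incU incV supU supV; split=> [i|B ub z].
  by apply: cu_leD2; [exact: supU.1 | exact: supV.1].
move=> /ideal_addE [a [b [/(ideal_supE incU supU)[i Ua]]]].
move=> /(ideal_supE incV supV)[j Vb] zle.
apply: (ub (maxn i j)); apply/ideal_addE; exists a, b; split=> //.
- exact: incU _ _ (leq_maxl i j) _ Ua.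
- exact: incV _ _ (leq_maxr i j) _ Vb.
Qed.

HB.instance Definition _ := isCu.Build T O1 O2 O3 O4.

Lemma principal0 : principal pm_zero = 0.
Proof. by []. Qed.

Lemma principalD x y : principal (pm_add x y) = principal x + principal y.
Proof.
apply: ideal_eq => z.
- move=> /principalE zle; apply/ideal_addE; exists x, y.
  by split=> //; exact: principal_mem.
- move=> /ideal_addE [a [b [/principalE ax /principalE yb zle]]].
  by apply/principalE/(pm_le_trans _ _ _ zle); apply: pm_leD2.
Qed.

Lemma principal_way x : principal x `<< principal x.
Proof.
by apply/ideal_wayP; exists x; [exact: principal_mem | exact: cu_le_refl].
Qed.

(** * Extending maps from the premonoid to its completion *)

Section Extension.
Variables (L : cuType) (f : P -> L).
Hypothesis f_mono : forall x y, pm_le x y -> f x <=: f y.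
Hypothesis f0 : f pm_zero = 0.
Hypothesis fD : forall x y, f (pm_add x y) = f x + f y.
Hypothesis f_compact : forall x, f x `<< f x.

(** [g D] is the least upper bound of [f] on [D]; it exists by (O1) along a cofinal chain. The last
    clause later presents elements of the limit as suprema. *)
Lemma ideal_extension : exists g : T -> L,
  [/\ cu_morphism g, forall x, g (principal x) = f x
    & forall D (u : nat -> P), (forall i, D (u i)) ->
        (forall x, D x -> exists i, pm_le x (u i)) -> is_sup_seq (f \o u) (g D)].
Proof.
have lubT D : exists s, (forall x, D x -> f x <=: s) /\
    (forall b, (forall x, D x -> f x <=: b) -> s <=: b).
  have [u [Du incu cof]] := ideal_cofinal D.
  have [s [ub lub]] := cuO1 (f \o u) (fun i j ij => f_mono (incu i j ij)).
  exists s; split=> [x /cof [i /f_mono xu]|b bub].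
    exact: cu_le_trans xu (ub i).
  by apply: lub => i; exact: bub.
have [g gP] := choice lubT.
have gub D x : D x -> f x <=: g D by exact: (gP D).1.
have glub D b : (forall x, D x -> f x <=: b) -> g D <=: b by exact: (gP D).2.
have gmono D D' : D <=: D' -> g D <=: g D'.
  by move=> DD'; apply: glub => x /DD'; exact: gub.
have gprin x : g (principal x) = f x.
  apply: cu_le_anti; last exact/gub/principal_mem.
  by apply: glub => y /principalE; exact: f_mono.
have gsup D (u : nat -> P) : (forall i, D (u i)) ->
    (forall x, D x -> exists i, pm_le x (u i)) -> is_sup_seq (f \o u) (g D).
  move=> Du cof; split=> [i|b ub]; first exact: gub.
  by apply: glub => x /cof [i /f_mono xu]; apply: cu_le_trans xu (ub i).
exists g; split=> //; split=> //.
- by rewrite -principal0 gprin.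
- move=> D D'.
  have [u [Du incu cofu]] := ideal_cofinal D.
  have [v [Dv incv cofv]] := ideal_cofinal D'.
  (* By (O4), [g D + g D'] is the supremum of the termwise sums along the two cofinal chains. *)
  have [ub lub] := cuO4 _ _ _ _ (fun i j ij => f_mono (incu i j ij))
    (fun i j ij => f_mono (incv i j ij)) (gsup D u Du cofu) (gsup D' v Dv cofv).
  apply: cu_le_anti.
    apply: glub => z /ideal_addE [x [y [/gub fx /gub fy /f_mono]]].
    by rewrite fD => zle; apply: cu_le_trans zle _; exact: cu_leD2.
  apply: lub => i; rewrite -fD; apply: gub; apply/ideal_addE.
  by exists (u i), (v i); split=> //; exact: pm_le_refl.
(* The compact element [f x] sits between [g D'] and [g D]. *)
- move=> D' D /ideal_wayP [x Dx /gmono D'x].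
  rewrite gprin in D'x.
  exact: way_below_trans_le D'x (@f_compact x) (gub _ _ Dx).
- move=> Z s incZ supZ; split=> [i|b ub]; first exact/gmono/supZ.1.
  apply: glub => x /(ideal_supE incZ supZ)[i Zx].
  by apply: cu_le_trans (gub _ _ Zx) (ub i).
Qed.

End Extension.
End IdealCompletion.

(** * Limits of sequences of countable algebraic Cu-semigroups *)

Section SequenceLimit.
Variables (S : nat -> cuType) (sigma : forall i j, S i -> S j).
Hypothesis seq_ind : inductive_sequence sigma.
Hypothesis seq_compact : forall i (x : S i), x `<< x.
Hypothesis seq_countable : forall i, countable [set: S i].

Local Notation sg i j := (@sigma i j).
Let Q : Type := {i : nat & S i}.
Implicit Types (p q r : Q).

Let sgK i j k (x : S i) : (i <= j)%N -> (j <= k)%N ->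
  sg j k (sg i j x) = sg i k x.
Proof. by move=> ij jk; exact: (ind_comp seq_ind ij jk x). Qed.

Let sg_le i j (x y : S i) : (i <= j)%N -> x <=: y -> sg i j x <=: sg i j y.
Proof. by move=> ij; exact: cu_mor_le (ind_cu seq_ind ij) _ _. Qed.

Let sgD i j (x y : S i) : (i <= j)%N -> sg i j (x + y) = sg i j x + sg i j y.
Proof. by move=> ij; exact: cu_morD (ind_cu seq_ind ij) _ _. Qed.

Let sg0 i j : (i <= j)%N -> sg i j 0 = 0.
Proof. by move=> ij; exact: cu_mor0 (ind_cu seq_ind ij). Qed.

(** Elements of different blocks are compared after being pushed to stage [k]. Letting [k] vary
    gives the preorder of the algebraic direct limit, with no quotient taken. *)
Definition seq_le_at k p q : Prop :=
  [/\ (tag p <= k)%N, (tag q <= k)%N &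
      sg (tag p) k (tagged p) <=: sg (tag q) k (tagged q)].

Definition seq_le p q : Prop := exists k, seq_le_at k p q.

Definition seq_add p q : Q :=
  let k := maxn (tag p) (tag q) in
  Tagged S (sg (tag p) k (tagged p) + sg (tag q) k (tagged q)).

Definition seq_zero : Q := Tagged S (0 : S 0%N).

Let seq_le_up k l p q : (k <= l)%N -> seq_le_at k p q -> seq_le_at l p q.
Proof.
move=> kl [pk qk /(sg_le kl)]; rewrite !sgK // => pq.
by split=> //; [exact: leq_trans pk kl | exact: leq_trans qk kl].
Qed.

Let sg_seq_add p q k : (tag p <= k)%N -> (tag q <= k)%N ->
  sg (tag (seq_add p q)) k (tagged (seq_add p q))
  = sg (tag p) k (tagged p) + sg (tag q) k (tagged q).
Proof.
move=> pk qk; have mk : (maxn (tag p) (tag q) <= k)%N by rewrite geq_max pk.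
by rewrite /= sgD // !sgK // ?leq_maxl ?leq_maxr.
Qed.

Let tag_seq_add p q k : (tag p <= k)%N -> (tag q <= k)%N ->
  (tag (seq_add p q) <= k)%N.
Proof. by move=> pk qk; rewrite geq_max pk. Qed.

Let seq_countableT : countable [set: Q].
Proof.
have inj i : exists c : S i -> nat, injective c.
  have /countable_injP [c cinj] := seq_countable i.
  by exists c => x y; apply: cinj; rewrite inE.
pose c i := sval (cid (inj i)).
have cinj i : injective (c i) by rewrite /c; case: cid.
apply/countable_injP; exists (fun p => pickle (tag p, c _ (tagged p))).
move=> [i x] [j y] _ _ /(pcan_inj pickleK) [/= ij].
by case: j / ij y => y /cinj ->.
Qed.

Let seq_le_refl p : seq_le p p.
Proof. by exists (tag p); split=> //; exact: cu_le_refl. Qed.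

Let seq_le_trans q p r : seq_le p q -> seq_le q r -> seq_le p r.
Proof.
move=> [k pq] [l qr]; exists (maxn k l).
have [pk qk {}pq] := seq_le_up (leq_maxl k l) pq.
have [_ rk {}qr] := seq_le_up (leq_maxr k l) qr.
by split=> //; apply: cu_le_trans pq qr.
Qed.

Let seq_le0 p : seq_le seq_zero p.
Proof. by exists (tag p); split=> //=; rewrite sg0 //; exact: cu_le0. Qed.

Let seq_leD2 p q r t : seq_le p q -> seq_le r t ->
  seq_le (seq_add p r) (seq_add q t).
Proof.
move=> [k pq] [l rt]; exists (maxn k l).
have [pk qk {}pq] := seq_le_up (leq_maxl k l) pq.
have [rk tk {}rt] := seq_le_up (leq_maxr k l) rt.
split; [exact: tag_seq_add.. |].
by rewrite !sg_seq_add //; exact: cu_leD2.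
Qed.

Let seq_addC p q : seq_le (seq_add p q) (seq_add q p).
Proof.
have [pk qk] := (leq_maxl (tag p) (tag q), leq_maxr (tag p) (tag q)).
exists (maxn (tag p) (tag q)); split; [exact: tag_seq_add.. |].
by rewrite !sg_seq_add // addrC; exact: cu_le_refl.
Qed.

Let seq_addA p q r :
  seq_le (seq_add p (seq_add q r)) (seq_add (seq_add p q) r).
Proof.
pose k := maxn (tag p) (maxn (tag q) (tag r)).
have pk : (tag p <= k)%N by rewrite leq_maxl.
have qk : (tag q <= k)%N by rewrite leq_max leq_maxl orbT.
have rk : (tag r <= k)%N by rewrite leq_max leq_maxr orbT.
have pqk := tag_seq_add pk qk; have qrk := tag_seq_add qk rk.
exists k; split; [exact: tag_seq_add.. |].
by do 4!rewrite sg_seq_add //; rewrite addrA; exact: cu_le_refl.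
Qed.

Let sg_seq_add0 p : sg (tag (seq_add seq_zero p)) (tag p)
  (tagged (seq_add seq_zero p)) = sg (tag p) (tag p) (tagged p).
Proof. by rewrite sg_seq_add //= sg0 // add0r. Qed.

Let seq_add0_le p : seq_le (seq_add seq_zero p) p.
Proof.
exists (tag p); split=> //; first exact: tag_seq_add.
by rewrite sg_seq_add0; exact: cu_le_refl.
Qed.

Let seq_le_add0 p : seq_le p (seq_add seq_zero p).
Proof.
exists (tag p); split=> //; first exact: tag_seq_add.
by rewrite sg_seq_add0; exact: cu_le_refl.
Qed.

Definition seq_premonoid : premonoid :=
  Premonoid seq_countableT seq_le_refl seq_le_trans seq_le0 seq_leD2
    seq_addC seq_addA seq_add0_le seq_le_add0.

Local Notation T := (ideal_completion seq_premonoid).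

Definition seq_principal i (x : S i) : T :=
  @principal seq_premonoid (Tagged S x).

Lemma seq_principal_le i (x y : S i) : x <=: y ->
  seq_principal x <=: seq_principal y.
Proof.
move=> xy; apply: principal_mono; exists i; split=> //=.
exact: sg_le.
Qed.

(** Membership of [x] in the ideal of [y] is a comparison at some later stage, and the embedding
    hypothesis pulls it back to stage [i]. *)
Lemma seq_principal_reflect i (x y : S i) :
  (forall j, (i <= j)%N -> forall a b, sg i j a <=: sg i j b -> a <=: b) ->
  seq_principal x <=: seq_principal y -> x <=: y.
Proof.
move=> emb /(_ _ (@principal_mem seq_premonoid _)) /principalE [k [/= ik _]].
exact: emb.
Qed.

Lemma seq_principal_eq i j (x : S i) (y : S j) k :
  (i <= k)%N -> (j <= k)%N -> sg i k x = sg j k y ->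
  seq_principal x = seq_principal y.
Proof.
move=> ik jk xy.
by apply: cu_le_anti; apply: principal_mono; exists k; split=> //=;
  rewrite xy; exact: cu_le_refl.
Qed.

Lemma seq_principal_cocone : cu_cocone sigma seq_principal.
Proof.
split=> [i|i j ij x /=]; last first.
  by apply: (@seq_principal_eq _ _ _ _ j) => //; rewrite sgK.
apply: compact_cu_morphism => // [|x y|x y|x].
- by apply: (@seq_principal_eq _ _ _ (0 : S 0%N) i) => //; rewrite !sg0.
- rewrite /seq_principal -principalD.
  (* The sum built by [seq_add] lives at stage [maxn i i], which is not convertible to [i], so both
     sides are compared at stage [i]. *)
  apply: (@seq_principal_eq _ _ _ (tagged (seq_add (Tagged S x) (Tagged S y))) i) => //=.
    by rewrite maxnn.
  have := @sg_seq_add (Tagged S x) (Tagged S y) i (leqnn i) (leqnn i) => /= ->.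
  exact: sgD.
- exact: seq_principal_le.
- exact: principal_way.
Qed.

(** * Comparison of the limit with the ideal completion *)

Variables (L : cuType) (phi : forall i, S i -> L).
Hypothesis phi_limit : is_cu_limit sigma phi.

Let phi_cu i : cu_morphism (@phi i).
Proof. by case: phi_limit.1. Qed.

Let phiK i j (x : S i) : (i <= j)%N -> phi (sg i j x) = phi x.
Proof. by move=> ij; case: phi_limit.1 => _ /(_ i j ij x). Qed.

(** The universal map into the completion sends [phi x] to the principal ideal of [x], where the
    order is already known to be reflected. *)
Lemma limit_reflect i :
  (forall j, (i <= j)%N -> forall a b, sg i j a <=: sg i j b -> a <=: b) ->
  forall x y : S i, phi x <=: phi y -> x <=: y.
Proof.
move=> emb x y xy; have [h [hcu hphi _]] := phi_limit.2 _ _ seq_principal_cocone.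
apply: seq_principal_reflect emb _.
by have := cu_mor_le hcu xy; have /= -> := hphi i x; have /= -> := hphi i y.
Qed.

(* The ideal completion maps back to the limit compatibly with the cocones, so
   by uniqueness L -> T -> L is the identity. *)
Lemma limit_dense (x : L) : exists u : nat -> {i : nat & S i},
  is_sup_seq (fun k => phi (tagged (u k))) x.
Proof.
have [h [hcu hphi _]] := phi_limit.2 _ _ seq_principal_cocone.
pose f (p : seq_premonoid) : L := phi (tagged p).
have f_mono (p q : seq_premonoid) : pm_le p q -> f p <=: f q.
  move=> [k [pk qk /(cu_mor_le (phi_cu k))]].
  by rewrite /f !phiK.
have fD (p q : seq_premonoid) : f (pm_add p q) = f p + f q.
  by rewrite /f /= (cu_morD (phi_cu _)) !phiK // ?leq_maxl ?leq_maxr.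
have f_compact (p : seq_premonoid) : f p `<< f p by apply: (cu_mor_way (phi_cu _)).
have [g [gcu gprin gsup]] := ideal_extension f_mono (cu_mor0 (phi_cu 0%N)) fD f_compact.
have [e [_ _ euniq]] := phi_limit.2 _ _ phi_limit.1.
have ghE : g (h x) = x.
  have ghphi i : (g \o h) \o @phi i =1 @phi i.
    by move=> y /=; have /= -> := hphi i y; exact: gprin.
  rewrite -[g _]/((g \o h) x) (euniq _ (cu_morphism_comp gcu hcu) ghphi).
  by rewrite -(euniq _ (cu_morphism_id L)).
(* A chain cofinal in the ideal [h x] yields images of block elements with supremum [g (h x)], that
   is, [x]. *)
have [u [Du _ cof]] := ideal_cofinal (h x).
by exists u; rewrite -ghE; exact: gsup.
Qed.

(** Images of block elements are comparable at a common stage. Either each [u k] is below some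
    [v l], so [x] is below [y], or some [u k] dominates every [v l], hence [y]. *)
Lemma limit_total :
  (forall i (x y : S i), x <=: y \/ y <=: x) ->
  forall x y : L, x <=: y \/ y <=: x.
Proof.
move=> tot x y.
have [u [uub ulub]] := limit_dense x; have [v [vub vlub]] := limit_dense y.
have totP p q : phi (tagged p) <=: phi (tagged q) \/
    phi (tagged q) <=: phi (tagged p).
  rewrite -(phiK _ (leq_maxl (tag p) (tag q))).
  rewrite -(phiK (tagged q) (leq_maxr (tag p) (tag q))).
  by have [pq|qp] := tot _ (sg _ (maxn (tag p) (tag q)) (tagged p))
    (sg _ (maxn (tag p) (tag q)) (tagged q)); [left|right]; apply: cu_mor_le.
have [below|/existsNP [k /forallNP nbelow]] :=
    pselect (forall k, exists l, phi (tagged (u k)) <=: phi (tagged (v l))).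
  left; apply: ulub => k; have [l ul] := below k.
  exact: cu_le_trans ul (vub l).
right; apply: vlub => l; apply: cu_le_trans (uub k).
by case: (totP (u k) (v l)) => // /nbelow.
Qed.

End SequenceLimit.

(** * The elementary semigroups and their limits *)

Section ElementaryTheory.
Variable m : nat.
Local Notation E := (elementary m).
Implicit Types x y : E.

Lemma elem_total x y : x <=: y \/ y <=: x.
Proof.
case: x y => [i|] [j|]; [|by left|by right|by left].
by case/orP: (leq_total i j) => h; [left|right].
Qed.

(** With infinity given rank [m.+1], ranks are bounded, so a sequence has a term of maximal rank,
    and this term is above its supremum. *)
Lemma elem_compact x : x `<< x.
Proof.
move=> z s _ [_ lub] xs.
pose rank (y : E) : nat := if y is Some i then i else m.+1.
have rank_le y : (rank y <= m.+1)%N by case: y => [i|] //=; exact: ltnW.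
have le_rank y t : (rank y <= rank t)%N -> y <=: t.
  by case: y t => [i|] [j|] //=; rewrite leqNgt ltn_ord.
have ex : exists k, `[<exists i, rank (z i) = k>].
  by exists (rank (z 0%N)); apply/asboolP; exists 0%N.
have ub k : `[<exists i, rank (z i) = k>] -> (k <= m.+1)%N.
  by move=> /asboolP [i <-].
case: (ex_maxnP ex ub) => k /asboolP [i zi] kmax; exists i.
apply: cu_le_trans xs _; apply: lub => j; apply: le_rank; rewrite zi.
by apply: kmax; apply/asboolP; exists j.
Qed.

Lemma elem_countable : countable [set: E].
Proof. exact: (@countableP (option 'I_m.+1)). Qed.

Lemma elem_le_top x : x <=: (None : E).
Proof. by case: x. Qed.

Lemma elem_SomeE (i : 'I_m.+1) : Some i = elem_one m *+ i :> E.
Proof. by rewrite elem_mulrn valK. Qed.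

Lemma elem_mulrn_top x : x <> 0 -> x *+ m.+1 = (None : E).
Proof.
case: x => [i|_]; last by rewrite mulrS.
move=> i0; rewrite elem_SomeE -mulrnA elem_mulrn insubF //.
apply/negbTE; rewrite -leqNgt leq_pmull // lt0n.
by apply/eqP => i00; apply: i0; congr Some; exact: val_inj.
Qed.

Lemma elem_oneMn_inj (k l : nat) : (k <= m)%N -> (l <= m)%N ->
  elem_one m *+ k = elem_one m *+ l -> k = l.
Proof.
move=> km lm; rewrite !elem_mulrn.
by rewrite (insubT (fun i => i < m.+1)%N km) (insubT (fun i => i < m.+1)%N lm) => -[].
Qed.

End ElementaryTheory.

(** Reflecting the order forces injectivity, and the two sets have [m.+2] and [p.+2] elements. *)
Lemma elem_embedding_le (m p : nat) (f : elementary m -> elementary p) :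
  order_embedding f -> (m <= p)%N.
Proof.
move=> [_ emb].
have finj : injective f.
  by move=> x y fxy; apply: cu_le_anti; apply: emb; rewrite fxy; exact: cu_le_refl.
by have := @leq_card (option 'I_m.+1) (option 'I_p.+1) f finj; rewrite !card_option !card_ord !ltnS.
Qed.

(** The products [n * i] never exceed [n ^ k.+1], so finite elements stay finite and are ordered as
    integers. *)
Lemma en_hom_mul (n k : nat) : (1 <= n)%N -> en_hom (@elem_mul n 1 k k.+1).
Proof.
move=> n_gt0; set f := elem_mul _ _.
have fE (i : 'I_(n ^ k).+1) : exists2 j : 'I_(n ^ k.+1).+1,
    f (Some i) = Some j & nat_of_ord j = (n * i)%N.
  have lt : (n * i < (n ^ k.+1).+1)%N.
    by rewrite ltnS expnS leq_mul2l -ltnS ltn_ord orbT.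
  by exists (Ordinal lt) => //; rewrite /f /= expn1 elem_mulrn insubT.
have fle (x y : en_obj n k) : (f x <=: f y) <-> (x <=: y).
  case: x y => [i|] [j|] //.
  - have [i' -> i'E] := fE i; have [j' -> j'E] := fE j.
    by rewrite /cu_le /= i'E j'E leq_pmul2l.
  - by have [i' -> _] := fE i.
  - by have [j' -> _] := fE j.
split; last by exists 1%N.
split; last by move=> x y /fle.
apply: compact_cu_morphism.
- exact: elem_compact.
- by rewrite /f /= muln0 mulr0n.
- move=> [i|] [j|] //; last by have [i' fi _] := fE i; rewrite fi.
  rewrite {1}/GRing.add /=; case: insubP => [t _ tE|]; rewrite /f /= expn1.
    by rewrite tE mulnDr mulrnDr.
  (* Overflow persists: [i + j] is at least [n ^ k + 1], so [n * (i + j)] is at least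
     [n ^ k.+1 + n]. *)
  rewrite -leqNgt -mulrnDr -mulnDr elem_mulrn => ij; rewrite insubF //.
  apply/negbTE; rewrite -leqNgt expnS.
  by apply: leq_trans (_ : n * (n ^ k).+1 <= _)%N; rewrite ?ltn_pmul2l ?leq_pmul2l.
- by move=> x y /fle.
- by move=> x; exact: elem_compact.
Qed.

(** * Properties of the Fraïssé limit *)

Section FraisseLimit.
Variables (n : nat) (n_ge1 : (1 <= n)%N) (L : cuType).
Variables (a : nat -> nat) (sigma : forall i j, en_obj n (a i) -> en_obj n (a j)).
Variable phi : forall i, en_obj n (a i) -> L.
Hypothesis sigma_fraisse : @fraisse_sequence (en n_ge1) a sigma.
Hypothesis phi_limit : is_cu_limit sigma phi.

Let sigma_ind : inductive_sequence sigma := fr_ind sigma_fraisse.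

Let sigma_hom i j (ij : (i <= j)%N) : en_hom (@sigma i j) :=
  fr_hom sigma_fraisse ij.

Let phi_cu i : cu_morphism (@phi i).
Proof. by case: phi_limit.1. Qed.

Let obj_compact i (x : en_obj n (a i)) : x `<< x.
Proof. exact: elem_compact. Qed.

Let obj_countable i : countable [set: en_obj n (a i)].
Proof. exact: elem_countable. Qed.

Let phi_reflect i (x y : en_obj n (a i)) : phi x <=: phi y -> x <=: y.
Proof.
apply: (limit_reflect sigma_ind obj_compact obj_countable phi_limit) => j ij.
by have [[_ +] _] := sigma_hom ij.
Qed.

Let dense (x : L) : exists u : nat -> {i : nat & en_obj n (a i)},
  is_sup_seq (fun k => phi (tagged (u k))) x.
Proof.
exact: (limit_dense sigma_ind obj_compact obj_countable phi_limit).
Qed.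

(** Multiplication maps send infinity to infinity, so both sides agree with the top of a common
    later stage. *)
Let phi_top i j : phi (None : en_obj n (a i)) = phi (None : en_obj n (a j)).
Proof.
suff top k l : (k <= l)%N ->
    phi (None : en_obj n (a k)) = phi (None : en_obj n (a l)).
  by rewrite (top i _ (leq_maxl i j)) (top j _ (leq_maxr i j)).
move=> kl; case: phi_limit.1 => _ /(_ k l kl None) /= <-.
by have [_ [e ->]] := sigma_hom kl.
Qed.

Let phi_top_max i (x : L) : x <=: phi (None : en_obj n (a i)).
Proof.
have [u [_ lub]] := dense x; apply: lub => k.
rewrite (phi_top i (tag (u k))); apply: (cu_mor_le (phi_cu _)).
exact: elem_le_top.
Qed.

Let phi_eq0 i (x : en_obj n (a i)) : phi x = 0 -> x = 0.
Proof.
move=> px0; apply: cu_le_anti (cu_le0 _); apply: phi_reflect.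
by rewrite px0; exact: cu_le0.
Qed.

Lemma fraisse_limit_simple : cu_simple L.
Proof.
move=> I idI.
have [I0|/existsNP [x /not_implyP [Ix x0]]] := pselect (forall x, I x -> x = 0).
  by left; apply/seteqP; split=> x; [exact: I0 | move=> ->; exact: cu_ideal0 idI].
right; apply/seteqP; split=> // y _.
have [u [ub lub]] := dense x.
have [k uk0] : exists k, phi (tagged (u k)) <> 0.
  apply: contrapT => /forallNP u0; apply: x0.
  apply: cu_le_anti (cu_le0 _); apply: lub => k.
  by have /contrapT -> := u0 k; exact: cu_le_refl.
(* It suffices that the top lies in [I]: it is a multiple of the image of [u k], which is nonzero
   and below [x]. *)
apply: (cu_ideal_le idI (phi_top_max (tag (u k)) y)).
rewrite -(@elem_mulrn_top _ (tagged (u k))); last first.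
  by move=> uk; apply: uk0; rewrite uk (cu_mor0 (phi_cu _)).
rewrite (cu_morMn _ _ (phi_cu _)); apply: cu_idealMn => //.
exact: (cu_ideal_le idI (ub k) Ix).
Qed.

Lemma fraisse_limit_not_stably_finite : ~ stably_finite L.
Proof.
(* Stage 0 is an arbitrary choice, as all tops coincide by [phi_top]. *)
pose top := phi (None : en_obj n (a 0%N)).
have topD : top = top + top by rewrite -(cu_morD (phi_cu _)).
move=> /(_ top) sf; apply: (sf _ top _ topD).
  by exists top; apply: (cu_mor_way (phi_cu _)); exact: elem_compact.
by move=> /phi_eq0.
Qed.

Lemma fraisse_limit_total (x y : L) : x <=: y \/ y <=: x.
Proof.
apply: (limit_total sigma_ind obj_compact obj_countable phi_limit) => i.
exact: elem_total.
Qed.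

(** Absorbing multiplication by [n] out of stage [i], with the empty finite set, gives an embedding
    of the block of size [n ^ (a i).+1] into a later one, so the sizes grow strictly. *)
Lemma fraisse_sequence_unbounded (N : nat) : (2 <= n)%N ->
  exists i, (N <= n ^ a i)%N.
Proof.
move=> n_ge2; elim: N => [|N [i Ni]]; first by exists 0%N.
have [j [_ [beta [[/elem_embedding_le le _] _]]]] :=
  fr_absorb sigma_fraisse (finite_set0 _) (en_hom_mul (a i) n_ge1).
exists j; apply: leq_trans le; apply: leq_ltn_trans Ni _.
by rewrite ltn_exp2l.
Qed.

Lemma fraisse_limit_not_weakly_purely_infinite :
  (2 <= n)%N -> ~ weakly_purely_infinite L.
Proof.
move=> n_ge2 [m m_gt0 wpi].
(* In a block of size at least [m * 2] both multiples of 1 under comparison are finite, hence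
   distinct. *)
have [i mi] := fraisse_sequence_unbounded (m * 2) n_ge2.
have := wpi (phi (elem_one _ : en_obj n (a i))).
rewrite -mulrnA -!(cu_morMn _ _ (phi_cu _)) => eq_phi.
have : elem_one (n ^ a i) *+ m = elem_one (n ^ a i) *+ (m * 2).
  by apply: cu_le_anti; apply: phi_reflect; rewrite eq_phi; exact: cu_le_refl.
move/elem_oneMn_inj => /(_ (leq_trans (leq_pmulr m (isT : 0 < 2)%N) mi) mi) /eqP.
by rewrite -{1}[m]muln1 eqn_pmul2l.
Qed.

End FraisseLimit.

(* The guard [(2 <= n)%N] is needed: for n = 1 the only object is
   E_1 = {0, 1, oo}, which is its own limit and satisfies 2x = 4x for all x. *)
Theorem corollary4p18 (n : nat) (n_ge1 : (1 <= n)%N) (L : cuType)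
    (hL : is_fraisse_limit (en n_ge1) L) :
  [/\ cu_simple L,
      ~ stably_finite L,
      (2 <= n)%N -> ~ weakly_purely_infinite L &
      forall x y : L, x <=: y \/ y <=: x].
Proof.
case: hL => a [sigma [phi [fr lim]]]; split.
- exact: fraisse_limit_simple fr lim.
- exact: fraisse_limit_not_stably_finite fr lim.
- exact: fraisse_limit_not_weakly_purely_infinite fr lim.
- exact: fraisse_limit_total fr lim.
Qed.
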